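(* Suppose that $\rho:=\rho(\mathcal{A})\rho(\mathcal{B})<1$. Then the Stein matrix equation $\mathcal{X}=\mathcal{A}\mathcal{X}\mathcal{B}+\mathcal{C}$ is uniquely solvable, and therefore the linear matrix equation $X=Af(X)B+C$ is also uniquely solvable. Furthermore, the unique solution $X$ of $X=Af(X)B+C$ satisfies $$\limsup_{k\to\infty}\sqrt[k]{\Big\| X-\sum_{j=0}^{k-1}\mathcal{A}^j\Big[\sum_{i=0}^{n-1}G_i(C)\Big]\mathcal{B}^j\Big\|}\le\rho.$$
   Context: Let $m,n\ge 1$ be integers, $A,B,C\in\mathbb{C}^{m\times m}$, and let $f:\mathbb{C}^{m\times m}\to\mathbb{C}^{m\times m}$ satisfy (1) (''linear'' in the paper's sense) $f(PQ+RS)=f(P)f(Q)+f(R)f(S)$ for all $P,Q,R,S\in\mathbb{C}^{m\times m}$; (2) (period-$n$) $n$ is the least positive integer such that $f^{(n)}(P)=P$ for all $P\in\mathbb{C}^{m\times m}$. Here $f^{(i)}$ is the $i$-fold composition of $f$ with itself, and $f^{(0)}$ is the identity map. For $i\ge 1$ and $X\in\mathbb{C}^{m\times m}$ set $G_i(X)=\Big(\prod_{j=1}^i f^{(j-1)}(A)\Big) f^{(i)}(X)\Big(\prod_{j=1}^i f^{(i-j)}(B)\Big)$, with products ordered from left to right in increasing $j$, i.e. $G_i(X)=A f(A)\cdots f^{(i-1)}(A)\, f^{(i)}(X)\, f^{(i-1)}(B)\cdots f(B)B$; and $G_0(X)=X$. Set $\mathcal{A}=\prod_{i=1}^n f^{(i-1)}(A)=A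 f(A)\cdots f^{(n-1)}(A)$, $\mathcal{B}=\prod_{i=1}^n f^{(n-i)}(B)=f^{(n-1)}(B)\cdots f(B)B$, and $\mathcal{C}=\sum_{i=1}^{n}G_{i-1}(C)$. For a square matrix $M$, $\rho(M)$ denotes its spectral radius; $\|\cdot\|$ is a matrix norm on $\mathbb{C}^{m\times m}$. *)

(* Defs.v *)
From HB Require Import structures.
From mathcomp Require Import all_boot all_order all_algebra.
From mathcomp Require Import complex.
From mathcomp Require Import all_classical all_reals all_analysis.

Set Implicit Arguments.
Unset Strict Implicit.
Unset Printing Implicit Defensive.

Import Order.TTheory GRing.Theory Num.Theory.

Local Open Scope classical_set_scope.
Local Open Scope ring_scope.

(* The supremum is a maximum when 0 < m; for m = 0 it is sup set0 = 0.
   [eigenvalue] is about row vectors, which gives the same spectrum. *)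
Definition spectral_radius (R : realType) (m : nat) (M : 'M[R[i]]_m) : R :=
  sup [set Normc.normc a | a in [set a : R[i] | eigenvalue M a]].

(* A norm on the complex vector space of m x m matrices; submultiplicativity
   is not required, so both usual meanings of "matrix norm" are covered. *)
Record is_matrix_norm (R : realType) (m : nat) (N : 'M[R[i]]_m -> R) : Prop :=
  IsMatrixNorm {
    matrix_norm_ge0 : forall P, 0 <= N P;
    matrix_norm_eq0 : forall P, N P = 0 -> P = 0;
    matrix_normZ : forall (a : R[i]) P, N (a *: P) = Normc.normc a * N P;
    matrix_normD : forall P Q, N (P + Q) <= N P + N Q }.

(* This is not linearity in the sense of vector spaces: for instance
   entrywise complex conjugation satisfies it. *)
Definition mul_add_linear (K : fieldType) (m : nat) (f : 'M[K]_m -> 'M[K]_m) :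
    Prop :=
  forall P Q S T, f (P *m Q + S *m T) = f P *m f Q + f S *m f T.

Definition has_period (T : Type) (f : T -> T) (n : nat) : Prop :=
  [/\ (0 < n)%N,
      forall x, iter n f x = x
    & forall k : nat, (0 < k)%N -> (forall x, iter k f x = x) -> (n <= k)%N].

Section SteinData.
Variables (K : fieldType) (m : nat) (f : 'M[K]_m -> 'M[K]_m).

(* A f(A) ... f^(i-1)(A) *)
Definition left_prod (i : nat) (A : 'M[K]_m) : 'M[K]_m :=
  \prod_(1 <= j < i.+1) iter (j - 1) f A.

(* f^(i-1)(B) ... f(B) B *)
Definition right_prod (i : nat) (B : 'M[K]_m) : 'M[K]_m :=
  \prod_(1 <= j < i.+1) iter (i - j) f B.

(* For i = 0 both products are empty, so that G 0 X = X. *)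
Definition G (A B : 'M[K]_m) (i : nat) (X : 'M[K]_m) : 'M[K]_m :=
  left_prod i A *m iter i f X *m right_prod i B.

Definition calA (n : nat) (A : 'M[K]_m) : 'M[K]_m := left_prod n A.

Definition calB (n : nat) (B : 'M[K]_m) : 'M[K]_m := right_prod n B.

Definition calC (n : nat) (A B C : 'M[K]_m) : 'M[K]_m :=
  \sum_(1 <= i < n.+1) G A B (i - 1) C.

End SteinData.

(* Main.v *)
(* A surjective map that is linear in the paper's sense is a ring automorphism,
   so substituting X = A f(X) B + C into itself n times gives the Stein
   equation.  Conversely, X |-> A f(X) B + C maps solutions of the Stein
   equation to solutions, so a unique Stein solution solves the original one.
   Everything else follows from calA^k X calB^k = O(t^k) for every t > rho:
   with t < 1 the homogeneous Stein equation has only the zero solution, hence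
   in finite dimension the Stein equation is uniquely solvable, and
   calA^k X calB^k is the error of the k-th partial sum. *)
Require Import Defs.
From HB Require Import structures.
From mathcomp Require Import all_boot all_order all_algebra.
From mathcomp Require Import complex.
From mathcomp Require Import all_classical all_reals all_analysis.
From mathcomp Require Import ring lra.

Set Implicit Arguments.
Unset Strict Implicit.
Unset Printing Implicit Defensive.

Import Order.TTheory GRing.Theory Num.Theory.

Local Open Scope classical_set_scope.
Local Open Scope ring_scope.

(** * Algebra of [f], of the maps [G], and of the two equations *)

Section PeriodicMorphism.
Variables (K : fieldType) (m n : nat) (f : 'M[K]_m -> 'M[K]_m).
Hypotheses (f_linear : mul_add_linear f) (f_period : has_period f n).

Lemma periodic_surj (Q : 'M[K]_m) : exists P, f P = Q.
Proof.
case: f_period; case: n => // k _ fk _.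
by exists (iter k f Q); exact: fk.
Qed.

(** By surjectivity f(Q) can be replaced by an arbitrary Q in f(0) = f(Q) f(0) + f(0) f(0). Then Q =
    0 makes f(0) idempotent and Q = 1 gives f(0) = f(0) + f(0). *)
Lemma mul_add_linear0 : f 0 = 0.
Proof.
have f0E Q : f 0 = Q *m f 0 + f 0 *m f 0.
  have [P <-] := periodic_surj Q.
  by rewrite -f_linear !mulmx0 addr0.
have /esym e2 : f 0 = f 0 *m f 0 by have := f0E 0; rewrite mul0mx add0r.
have := f0E 1%:M; rewrite mul1mx e2 => /eqP.
by rewrite -subr_eq0 opprD addrA subrr add0r oppr_eq0 => /eqP.
Qed.

Lemma mul_add_linearM P Q : f (P *m Q) = f P *m f Q.
Proof.
by have := f_linear P Q 0 0; rewrite mul_add_linear0 !mulmx0 !addr0.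
Qed.

Lemma mul_add_linear1 : f 1%:M = 1%:M.
Proof.
have [P fP] := periodic_surj 1%:M.
by rewrite -[RHS]fP -[P in RHS]mulmx1 mul_add_linearM fP mul1mx.
Qed.

Lemma mul_add_linearD P Q : f (P + Q) = f P + f Q.
Proof.
by rewrite -[P]mulmx1 -[Q]mul1mx f_linear mul_add_linear1 !mulmx1 !mul1mx.
Qed.

Lemma mul_add_linear_sum (I : Type) (s : seq I) (F : I -> 'M[K]_m) :
  f (\sum_(i <- s) F i) = \sum_(i <- s) f (F i).
Proof. exact: (big_morph f mul_add_linearD mul_add_linear0). Qed.

Lemma left_prodSr i A : left_prod f i.+1 A = left_prod f i A *m iter i f A.
Proof. by rewrite /left_prod big_nat_recr //= subn1. Qed.

(** Multiplicativity lets the first factor be peeled off instead of the last one, which is the form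
    produced by substituting the equation into itself. *)
Lemma left_prodS i A : left_prod f i.+1 A = A *m f (left_prod f i A).
Proof.
elim: i => [|i IH].
  rewrite left_prodSr /left_prod big_geq //= [f 1]mul_add_linear1.
  by rewrite mulmx1 mul1mx.
by rewrite left_prodSr [in LHS]IH -mulmxA -mul_add_linearM -left_prodSr.
Qed.

Lemma right_prodSl i B : right_prod f i.+1 B = iter i f B *m right_prod f i B.
Proof.
by rewrite /right_prod big_nat_recl //= subn1.
Qed.

Lemma right_prodS i B : right_prod f i.+1 B = f (right_prod f i B) *m B.
Proof.
elim: i => [|i IH].
  rewrite right_prodSl /right_prod big_geq //= [f 1]mul_add_linear1.
  by rewrite mulmx1 mul1mx.
by rewrite right_prodSl [in LHS]IH mulmxA -mul_add_linearM -right_prodSl.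
Qed.

Variables (A B C : 'M[K]_m).

Lemma G0 X : G f A B 0 X = X.
Proof. by rewrite /G /left_prod /right_prod !big_geq //= mul1mx mulmx1. Qed.

(** Hence [G f A B i] is the i-th iterate of the homogeneous part X |-> A f(X) B. *)
Lemma GS i X : G f A B i.+1 X = A *m f (G f A B i X) *m B.
Proof. by rewrite /G left_prodS right_prodS !mul_add_linearM !mulmxA. Qed.

Lemma G_period X : G f A B n X = calA f n A *m X *m calB f n B.
Proof. by case: f_period => _ fn _; rewrite /G fn. Qed.

Lemma calC_sum : calC f n A B C = \sum_(0 <= i < n) G f A B i C.
Proof.
by rewrite /calC big_add1; apply: eq_bigr => i _; rewrite subn1.
Qed.

(** The homogeneous part shifts every index by one and C supplies the missing term of index 0. For k
    = n the surplus term is [calA] C [calB]. *)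
Lemma G_step_sum k :
  A *m f (\sum_(0 <= i < k) G f A B i C) *m B + C =
  \sum_(0 <= i < k) G f A B i C + G f A B k C.
Proof.
rewrite -big_nat_recr // big_nat_recl // G0 addrC; congr (_ + _).
rewrite mul_add_linear_sum mulmx_sumr mulmx_suml.
by apply: eq_bigr => i _; rewrite GS.
Qed.

Lemma solution_expand X k : X = A *m f X *m B + C ->
  X = G f A B k X + \sum_(0 <= i < k) G f A B i C.
Proof.
move=> XE; elim: k => [|k IH]; first by rewrite G0 big_geq // addr0.
rewrite {1}XE {1}IH mul_add_linearD mulmxDr mulmxDl -addrA G_step_sum -GS.
by rewrite big_nat_recr.
Qed.

Lemma solution_stein X : X = A *m f X *m B + C ->
  X = calA f n A *m X *m calB f n B + calC f n A B C.
Proof. by move=> /(solution_expand n); rewrite G_period calC_sum. Qed.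

(* The map X |-> A f(X) B + C commutes with the Stein operator because
   A f(calA) = calA A and f(calB) B = B calB. *)
Lemma stein_step X : X = calA f n A *m X *m calB f n B + calC f n A B C ->
  let Y := A *m f X *m B + C in
  Y = calA f n A *m Y *m calB f n B + calC f n A B C.
Proof.
move=> XE /=; have [_ fn _] := f_period.
have AE : A *m f (calA f n A) = calA f n A *m A.
  by rewrite /calA -left_prodS left_prodSr fn.
have BE : f (calB f n B) *m B = B *m calB f n B.
  by rewrite /calB -right_prodS right_prodSl fn.
rewrite {1}XE mul_add_linearD [in LHS]mulmxDr [in LHS]mulmxDl -addrA.
rewrite calC_sum G_step_sum !mul_add_linearM !mulmxA AE -!mulmxA BE G_period.
by rewrite mulmxDl mulmxDr !mulmxA -!addrA; congr (_ + _); rewrite addrC.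
Qed.

Lemma stein_expand X k : X = calA f n A *m X *m calB f n B + calC f n A B C ->
  X - \sum_(0 <= j < k) (calA f n A ^+ j
         *m (\sum_(0 <= i < n) G f A B i C) *m calB f n B ^+ j) =
  calA f n A ^+ k *m X *m calB f n B ^+ k.
Proof.
rewrite calC_sum; move: (calA f n A) (calB f n B) (\sum_(0 <= i < n) _).
move=> P Q D XE; apply/eqP; rewrite subr_eq; apply/eqP.
elim: k => [|k IH].
  by rewrite big_geq // !expr0 addr0 [1%R *m _]mul1mx [_ *m 1%R]mulmx1.
rewrite {1}IH {1}XE big_nat_recr //= mulmxDr mulmxDl exprSr exprS.
by rewrite !mulmxA -addrA; congr (_ + _); rewrite addrC.
Qed.

End PeriodicMorphism.

(** * Norms on complex matrices *)

Section Norms.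
Variable (R : realType).
Implicit Types (z : R[i]).
Local Notation normc := (@Normc.normc R).

Lemma normc_ge0 z : 0 <= normc z.
Proof. by case: z => a b; exact: sqrtr_ge0. Qed.

(** An auxiliary submultiplicative norm: products are estimated in it, and the result is carried to
    an arbitrary norm by [matrix_norm_le_entry_norm]. *)
Definition entry_norm (m : nat) (P : 'M[R[i]]_m) : R :=
  \sum_i \sum_j normc (P i j).

Variable m : nat.
Implicit Types P Q : 'M[R[i]]_m.

Lemma entry_norm_ge0 P : 0 <= entry_norm P.
Proof. by apply: sumr_ge0 => i _; apply: sumr_ge0 => j _; exact: normc_ge0. Qed.

Lemma entry_norm_is_matrix_norm : is_matrix_norm (@entry_norm m).
Proof.
split => [|P P0|a P|P Q]; first exact: entry_norm_ge0.
- apply/matrixP => i j; rewrite mxE; apply: Normc.eq0_normc; apply/eqP.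
  move: P0 => /eqP; rewrite psumr_eq0 => [/allP/(_ i)|k _]; last first.
    by apply: sumr_ge0 => l _; exact: normc_ge0.
  rewrite mem_index_enum /= => /(_ isT).
  rewrite psumr_eq0 => [/allP/(_ j)|k _]; last exact: normc_ge0.
  by rewrite mem_index_enum => /(_ isT).
- rewrite /entry_norm mulr_sumr; apply: eq_bigr => i _.
  by rewrite mulr_sumr; apply: eq_bigr => j _; rewrite mxE Normc.normcM.
- rewrite /entry_norm -big_split /=; apply: ler_sum => i _.
  rewrite -big_split /=; apply: ler_sum => j _.
  by rewrite mxE; exact: le_normcD.
Qed.

Lemma normc_sum (I : Type) (s : seq I) (F : I -> R[i]) :
  normc (\sum_(i <- s) F i) <= \sum_(i <- s) normc (F i).
Proof.
elim/big_rec2: _ => [|i y x _ xy]; first by rewrite Normc.normc0.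
by apply: (le_trans (le_normcD _ _)); rewrite lerD2l.
Qed.

Lemma entry_normM P Q : entry_norm (P *m Q) <= entry_norm P * entry_norm Q.
Proof.
rewrite /entry_norm mulr_suml; apply: ler_sum => i _.
apply: (@le_trans _ _ (\sum_j \sum_k normc (P i k) * normc (Q k j))).
  apply: ler_sum => j _; rewrite mxE; apply: (le_trans (normc_sum _ _)).
  by apply: ler_sum => k _; rewrite Normc.normcM.
rewrite exchange_big mulr_suml; apply: ler_sum => k _ /=.
rewrite -mulr_sumr ler_wpM2l ?normc_ge0 //.
(* The absolute sum of row k of Q is at most the whole norm of Q. *)
rewrite [leRHS](bigD1 k) //= lerDl.
by apply: sumr_ge0 => l _; apply: sumr_ge0 => j _; exact: normc_ge0.
Qed.

Lemma matrix_norm0 (N : 'M[R[i]]_m -> R) : is_matrix_norm N -> N 0 = 0.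
Proof. by case=> _ _ NZ _; rewrite -(scale0r 0) NZ Normc.normc0 mul0r. Qed.

Lemma matrix_norm_sum (N : 'M[R[i]]_m -> R) (I : Type) (s : seq I)
    (F : I -> 'M[R[i]]_m) :
  is_matrix_norm N -> N (\sum_(i <- s) F i) <= \sum_(i <- s) N (F i).
Proof.
move=> NN; elim/big_rec2: _ => [|i y x _ xy]; first by rewrite matrix_norm0.
by apply: (le_trans (matrix_normD NN _ _)); rewrite lerD2l.
Qed.

Lemma matrix_norm_le_entry_norm (N : 'M[R[i]]_m -> R) : is_matrix_norm N ->
  exists2 c, 0 <= c & forall P, N P <= c * entry_norm P.
Proof.
move=> NN; have N0 := matrix_norm_ge0 NN.
(* P is expanded in the matrix units; c dominates the norm of each of them. *)
pose c := \sum_i \sum_j N (delta_mx i j).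
exists c => [|P]; first by apply: sumr_ge0 => i _; exact: sumr_ge0.
rewrite {1}[P]matrix_sum_delta; apply: (le_trans (matrix_norm_sum _ _ NN)).
rewrite mulr_sumr; apply: ler_sum => i _.
apply: (le_trans (matrix_norm_sum _ _ NN)).
rewrite mulr_sumr; apply: ler_sum => j _.
rewrite matrix_normZ // mulrC ler_wpM2r ?normc_ge0 //.
rewrite /c (bigD1 i) //= (bigD1 j) //= -addrA lerDl addr_ge0 ?sumr_ge0 //.
by move=> k _; exact: sumr_ge0.
Qed.

End Norms.

(** * Eigenvalues and the spectral radius *)

Section SpectralRadius.
Variables (R : realType) (m : nat).
Local Notation normc := (@Normc.normc R).

Lemma char_poly_roots (M : 'M[R[i]]_m) :
  {s : seq R[i] | char_poly M = \prod_(z <- s) ('X - z%:P)}.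
Proof.
have [s sE] := closed_field_poly_normal (char_poly M); exists s.
by rewrite sE (monicP (char_poly_monic M)) scale1r.
Qed.

Lemma eigenvalue_le_spectral_radius (M : 'M[R[i]]_m) (a : R[i]) :
  eigenvalue M a -> normc a <= spectral_radius M.
Proof.
move=> Ma; apply: ub_le_sup; last by exists a.
have [s sE] := char_poly_roots M.
(* Using the supremum requires an upper bound: the sum of the moduli of all roots of the
   characteristic polynomial. *)
exists (\sum_(z <- s) normc z) => _ [b /= Mb <-].
move: Mb; rewrite eigenvalue_root_char sE root_prod_XsubC => bs.
rewrite (big_rem b) //= lerDl; apply: sumr_ge0 => z _; exact: normc_ge0.
Qed.

Lemma spectral_radius_ge0 (M : 'M[R[i]]_m) : 0 <= spectral_radius M.
Proof.
have [[a Ma]|noM] := pselect (exists a, eigenvalue M a).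
  exact: le_trans (normc_ge0 a) (eigenvalue_le_spectral_radius Ma).
(* Without eigenvalues the supremum takes its default value 0. *)
rewrite /spectral_radius (_ : [set _ | _ in _] = set0) ?sup0 //.
by rewrite -subset0 => _ [a /= Ma _]; apply: noM; exists a.
Qed.

End SpectralRadius.

(** * Growth of matrix powers *)

Lemma affine_recurrence_bound (R : realFieldType) (a : nat -> R) (l r K : R) :
  0 <= l -> l < r -> (forall k, 0 <= a k) ->
  (forall k, a k.+1 <= l * a k + K * r ^+ k) ->
  exists K', forall k, a k <= K' * r ^+ k.
Proof.
move=> l0 lr a0 aS; have rl : 0 < r - l by rewrite subr_gt0.
have r0 : 0 <= r by exact/ltW/(le_lt_trans l0).
(* This K' satisfies a(0) <= K' and K <= (r - l) K'; the latter says l K' + K <= r K', which is the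
   induction step. *)
exists (a 0%N + `|K| / (r - l)); elim=> [|k IH].
  by rewrite expr0 mulr1 lerDl divr_ge0 // ltW.
apply: (le_trans (aS k)).
have /le_trans : l * a k + K * r ^+ k <=
    (l * (a 0%N + `|K| / (r - l)) + K) * r ^+ k.
  by rewrite mulrDl lerD2r -mulrA ler_wpM2l.
apply; rewrite exprS mulrA ler_wpM2r ?exprn_ge0 //.
rewrite addrC -lerBrDr mulrC -mulrBl (mulrC (_ - _)) mulrDl.
rewrite divfK ?gt_eqF // (le_trans (ler_norm K)) // lerDr.
by rewrite mulr_ge0 // ltW.
Qed.

Section PowerBound.
Variables (R : realType) (m : nat) (M : 'M[R[i]]_m.+1).

(* With char_poly M = (X - z_1)...(X - z_p), the sequences
   M^k (M - z_1)...(M - z_i) are bounded by descending induction on i: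
   they vanish for i = p by Cayley-Hamilton, and each one satisfies the
   recurrence a_(k+1) = z_i a_k + b_k where b is the next one. *)
Lemma expmx_bound (N : 'M[R[i]]_m.+1 -> R) (r : R) :
  is_matrix_norm N -> spectral_radius M < r ->
  exists K, forall k, N (M ^+ k) <= K * r ^+ k.
Proof.
move=> NN Mr; have [s sE] := char_poly_roots M.
suff : forall s2 s1, s = s1 ++ s2 -> exists K, forall k,
    N (M ^+ k * \prod_(z <- s1) (M - z%:M)) <= K * r ^+ k.
  by move=> /(_ s [::] erefl) [K KP]; exists K => k;
     have := KP k; rewrite big_nil mulr1.
elim=> [|z s2 IH] s1 s12.
  exists 0 => k; rewrite mul0r.
  rewrite (_ : \prod_(z <- s1) _ = 0) ?mulr0 ?matrix_norm0 //.
  rewrite -(Cayley_Hamilton M) sE s12 cats0 rmorph_prod.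
  by apply: eq_bigr => z _; rewrite rmorphB /= horner_mx_X horner_mx_C.
have [|K KP] := IH (rcons s1 z); first by rewrite cat_rcons.
have Mz : eigenvalue M z.
  by rewrite eigenvalue_root_char sE root_prod_XsubC s12 mem_cat mem_head orbT.
apply: (@affine_recurrence_bound _ _ (Normc.normc z) _ K) => [||k|k].
- exact: normc_ge0.
- exact: le_lt_trans (eigenvalue_le_spectral_radius Mz) Mr.
- exact: matrix_norm_ge0.
- have := KP k; rewrite -cats1 big_cat big_seq1 /=; set P := \prod_(_ <- _) _.
  (* Commutation turns M^(k+1) P into M^k P M, and splitting M = z + (M - z) then yields the
     recurrence. *)
  have cP : GRing.comm M P.
    rewrite /P; elim/big_rec: _ => [|y x _ cx]; first exact: commr1.
    apply: commrM => //; apply: commrB => //.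
    exact: (comm_mx_scalar y M).
  move=> Kk; rewrite (_ : M ^+ k.+1 * P = z *: (M ^+ k * P) +
                         M ^+ k * (P * (M - z%:M))).
    apply: (le_trans (matrix_normD NN _ _)).
    by rewrite matrix_normZ // lerD2l.
  rewrite !mulrBr (_ : P * z%:M = z *: P); last exact: mul_mx_scalar.
  rewrite exprSr -mulrA cP -scalerAr.
  by rewrite [RHS]addrC subrK.
Qed.

End PowerBound.

(** * Real estimates for products, powers and upper limits *)

Lemma mul_perturb (R : realFieldType) (a b t : R) : 0 <= a -> 0 <= b ->
  a * b < t -> exists2 e, 0 < e & (a + e) * (b + e) <= t.
Proof.
(* For e = d / D the summand d of D ensures e <= 1, so e (a + b + e) <= e (a + b + 1) <= e D = d. *)
move=> a0 b0 abt; pose d := t - a * b; pose D := a + b + 1 + d.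
have d0 : 0 < d by rewrite subr_gt0.
have D0 : 0 < D by rewrite /D; lra.
have e0 : 0 < d / D by exact: divr_gt0.
exists (d / D) => //.
have De : d / D * D = d by rewrite divfK // gt_eqF.
have e1 : d / D <= 1 by rewrite ler_pdivrMr // mul1r /D; lra.
have tE : t = a * b + d by rewrite /d addrC subrK.
move: (d / D) e0 e1 De tE => e e0 e1; rewrite /D => De ->.
have : e * e <= e * 1 by rewrite ler_wpM2l // ltW.
have : 0 <= e * d by rewrite mulr_ge0 // ltW.
by lra.
Qed.

Section Limits.
Import numFieldNormedType.Exports.

(** Since (s/t)^k tends to 0, a slightly larger base absorbs the constant K, so no limit of k-th
    roots of K is taken. *)
Lemma expr_dominates (R : realType) (K s t : R) : 0 <= s -> s < t ->
  exists M, forall k, (M <= k)%N -> K * s ^+ k <= t ^+ k.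
Proof.
move=> s0 st; have t0 : 0 < t by exact: le_lt_trans st.
have st1 : `|s / t| < 1.
  by rewrite ger0_norm ?divr_ge0 // ?ltr_pdivrMr ?mul1r // ltW.
have /cvgrPdist_le/(_ 1 ltr01)[M _ MP] :
    K * (s / t) ^+ k @[k --> \oo] --> K * 0.
  by apply: cvgMl_tmp; exact: cvg_expr.
exists M => k /MP /=; rewrite mulr0 sub0r normrN => /(le_trans (ler_norm _)).
by rewrite expr_div_n mulrA ler_pdivrMr ?exprn_gt0 // mul1r.
Qed.

Lemma limn_esup_le_eventually (R : realType) (u : (\bar R)^nat) (a : \bar R) :
  (exists M, forall k, (M <= k)%N -> (u k <= a)%E) -> (limn_esup u <= a)%E.
Proof.
move=> [M MP].
(* The upper limit is an infimum of suprema over neighbourhoods of infinity, and the tail from M is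
   one of them. *)
apply: (@le_trans _ _ (ereal_sup (u @` [set k | (M <= k)%N]))).
  by apply: ereal_inf_lbound; exists [set k | (M <= k)%N] => //; exists M.
by apply: ge_ereal_sup => _ [k /= /MP uk <-].
Qed.

End Limits.

(** * Decay of A^k X B^k and solvability of the Stein equation *)

Section SteinPowers.
Variables (R : realType) (m : nat) (A B : 'M[R[i]]_m.+1).
Let rho := spectral_radius A * spectral_radius B.

(** The gap between [rho] and t is shared between the factors: both spectral radii are raised by
    some e that keeps their product at most t, and [expmx_bound] applies to each. *)
Lemma stein_powers_bound (N : 'M[R[i]]_m.+1 -> R) (X : 'M[R[i]]_m.+1) (t : R) :
  is_matrix_norm N -> rho < t ->
  exists K, forall k, N (A ^+ k *m X *m B ^+ k) <= K * t ^+ k.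
Proof.
move=> NN rt; have a0 := spectral_radius_ge0 A.
have b0 := spectral_radius_ge0 B.
have [e e0 et] := mul_perturb a0 b0 rt.
have [|K1 K1P] := @expmx_bound _ _ A _ (spectral_radius A + e)
  (entry_norm_is_matrix_norm R m.+1).
  by rewrite ltrDl.
have [|K2 K2P] := @expmx_bound _ _ B _ (spectral_radius B + e)
  (entry_norm_is_matrix_norm R m.+1).
  by rewrite ltrDl.
have [c c0 cP] := matrix_norm_le_entry_norm NN.
(* The bound at k = 0 reads [entry_norm 1 <= K1]. *)
have K10 : 0 <= K1.
  have := K1P 0%N; rewrite expr0 mulr1; apply: le_trans.
  exact: entry_norm_ge0.
have K20 : 0 <= K2.
  have := K2P 0%N; rewrite expr0 mulr1; apply: le_trans.
  exact: entry_norm_ge0.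
have X0 := entry_norm_ge0 X.
move: (spectral_radius A) (spectral_radius B) a0 b0 et K1P K2P {rt}.
move=> a b a0 b0 et K1P K2P.
have ae0 : 0 <= a + e by rewrite addr_ge0 // ltW.
have be0 : 0 <= b + e by rewrite addr_ge0 // ltW.
move: (a + e) (b + e) ae0 be0 et K1P K2P => a' b' a'0 b'0 et K1P K2P.
exists (c * (K1 * entry_norm X * K2)) => k.
apply: (le_trans (cP _)); rewrite -[leRHS]mulrA ler_wpM2l //.
apply: (le_trans (entry_normM _ _)).
apply: (@le_trans _ _ (K1 * a' ^+ k * entry_norm X * (K2 * b' ^+ k))).
  apply: ler_pM => //; try exact: entry_norm_ge0.
  apply: (le_trans (entry_normM _ _)); exact: ler_wpM2r.
rewrite (_ : _ * _ = K1 * entry_norm X * K2 * (a' * b') ^+ k); last first.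
  by rewrite exprMn; ring.
rewrite ler_wpM2l ?mulr_ge0 // lerXn2r // nnegrE ?mulr_ge0 //.
exact: le_trans (mulr_ge0 a'0 b'0) et.
Qed.

Lemma stein_powers_limsup (N : 'M[R[i]]_m.+1 -> R) (X : 'M[R[i]]_m.+1) :
  is_matrix_norm N ->
  (limn_esup (fun k : nat =>
     (N (A ^+ k *m X *m B ^+ k) `^ (k%:R^-1))%:E) <= rho%:E)%E.
Proof.
move=> NN; have rho0 : 0 <= rho by rewrite mulr_ge0 ?spectral_radius_ge0.
apply/lee_addgt0Pr => e e0; rewrite -EFinD.
have [|K KP] := @stein_powers_bound N X (rho + e / 2) NN.
  by rewrite ltrDl divr_gt0.
apply: limn_esup_le_eventually.
have [M MP] : exists M, forall k, (M <= k)%N ->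
    K * (rho + e / 2) ^+ k <= (rho + e) ^+ k.
  apply: expr_dominates; first by rewrite addr_ge0 // divr_ge0 // ltW.
  by rewrite ltrD2l; lra.
(* The index k = 0 is excluded: there the exponent [k%:R^-1] is 0, so the term is 1 rather than a
   root. *)
exists M.+1 => k Mk; have k0 : (0 < k)%N by exact: leq_trans Mk.
rewrite lee_fin; have t0 : 0 <= rho + e by rewrite addr_ge0 // ltW.
have kk : (k%:R / k%:R : R) = 1 by rewrite divff // pnatr_eq0 -lt0n.
rewrite -[leRHS](powRr1 t0) -[in leRHS]kk.
rewrite powRrM powR_mulrn //.
rewrite ge0_ler_powR ?nnegrE ?invr_ge0 ?ler0n ?exprn_ge0 //.
  exact: matrix_norm_ge0.
exact: le_trans (KP k) (MP _ (ltnW Mk)).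
Qed.

Hypothesis rho_lt1 : rho < 1.

Lemma stein_hom_eq0 (X : 'M[R[i]]_m.+1) : X = A *m X *m B -> X = 0.
Proof.
move=> XE; have NN := entry_norm_is_matrix_norm R m.+1.
have rho0 : 0 <= rho by rewrite mulr_ge0 ?spectral_radius_ge0.
have Xk k : X = A ^+ k *m X *m B ^+ k.
  elim: k => [|k IH]; first by rewrite !expr0 [1%R *m _]mul1mx [_ *m 1%R]mulmx1.
  by rewrite {1}IH {1}XE exprSr exprS !mulmxA.
(* X equals A^k X B^k for every k, hence has norm at most K t^k; this tends to 0 because [rho] < t <
   1. *)
have [rt t1] := midf_lt rho_lt1; set t := (rho + 1) / 2 in rt t1.
have t0 : 0 <= t := le_trans rho0 (ltW rt).
have [K KP] := stein_powers_bound X NN rt.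
apply: (matrix_norm_eq0 NN); apply/eqP; rewrite eq_le matrix_norm_ge0 // andbT.
apply/ler_addgt0Pr => e e0; rewrite add0r.
(* Dominating K/e t^k by powers of 1 means that K t^k <= e eventually. *)
have [M MP] : exists M, forall k, (M <= k)%N ->
    K / e * t ^+ k <= 1 ^+ k by exact: expr_dominates.
have := MP M (leqnn _); rewrite expr1n mulrAC ler_pdivrMr // mul1r.
by apply: le_trans; rewrite {1}(Xk M); exact: KP.
Qed.

Lemma stein_unique_solution (D : 'M[R[i]]_m.+1) :
  exists! X : 'M[R[i]]_m.+1, X = A *m X *m B + D.
Proof.
(* T is X |-> X - A X B as an endomorphism of a finite-dimensional space; its kernel is zero by
   [stein_hom_eq0], so it is bijective. *)
pose T := linfun
  (idfun \- (mulmx A \o mulmxr B) : 'M[R[i]]_m.+1 -> 'M[R[i]]_m.+1).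
have TE X : T X = X - A *m X *m B by rewrite lfunE /= mulmxA.
have kerT : lker T == 0%VS.
  apply/lker0P => X Y; rewrite !TE => XY; apply/eqP.
  rewrite -subr_eq0; apply/eqP/stein_hom_eq0/eqP.
  by rewrite mulmxBr mulmxBl subr_eq addrAC -addrA -XY addrC subrK.
exists (T^-1%VF D); split=> [|Y YE].
  by apply/eqP; rewrite addrC -subr_eq -TE lker0_lfunVK.
apply: (lker0P kerT); rewrite lker0_lfunVK // TE.
by apply/eqP; rewrite eq_sym subr_eq addrC -YE.
Qed.

End SteinPowers.

Theorem theorem3p3 (R : realType) (m n : nat)
    (A B C : 'M[R[i]]_m) (f : 'M[R[i]]_m -> 'M[R[i]]_m)
    (N : 'M[R[i]]_m -> R)
    (m_gt0 : (0 < m)%N) (n_gt0 : (0 < n)%N)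
    (f_linear : mul_add_linear f)
    (f_period : has_period f n)
    (N_norm : is_matrix_norm N)
    (rho_lt1 :
      spectral_radius (calA f n A) * spectral_radius (calB f n B) < 1) :
  [/\ exists! X : 'M[R[i]]_m,
        X = calA f n A *m X *m calB f n B + calC f n A B C,
      exists! X : 'M[R[i]]_m, X = A *m f X *m B + C
    & forall X : 'M[R[i]]_m, X = A *m f X *m B + C ->
        (limn_esup (fun k : nat =>
           (N (X - \sum_(0 <= j < k)
                     (calA f n A ^+ j
                      *m (\sum_(0 <= i < n) G f A B i C)
                      *m calB f n B ^+ j))
            `^ (k%:R^-1))%:E)
         <= (spectral_radius (calA f n A) * spectral_radius (calB f n B))%:E)%E].
Proof.
case: m m_gt0 A B C f N f_linear f_period N_norm rho_lt1 => // {}m _.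
move=> {}A {}B {}C {}f {}N f_lin f_per NN rho_lt1.
have [X [XE Xuniq]] := stein_unique_solution rho_lt1 (calC f n A B C).
split.
- by exists X.
- exists X; split=> [|Y YE].
    (* A f(X) B + C is again a Stein solution, so uniqueness identifies it with X. *)
    exact: (Xuniq _ (stein_step f_lin f_per XE)).
  exact: (Xuniq _ (solution_stein f_lin f_per YE)).
- move=> Y /(solution_stein f_lin f_per) YE.
  rewrite (_ : (fun k => _) =
      fun k => (N (calA f n A ^+ k *m Y *m calB f n B ^+ k) `^ (k%:R^-1))%:E).
    exact: stein_powers_limsup.
  by apply/funext => k; rewrite stein_expand.
Qed.
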